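(* Let $n\in\mathbb{N}$ and let $\Phi$ be an $N$-function such that the function $\Psi(u):=\Phi(\sqrt{u})$ is convex on $[0,\infty)$. Let $(E,\mathcal{A},\mu)$ be a probability space and let $\{f_k\}_{k=1}^n\subset L_\Phi(E)\cap L^2(E)$ be a system of linearly independent functions. Suppose there exists a constant $C$ such that for any real numbers $a_1,\dots,a_n$ the inequality \[ \Big\|\sum_{k=1}^n a_k f_k\Big\|_{L_\Phi(E)}\le C\,\Big\|\sum_{k=1}^n a_k f_k\Big\|_{L^2(E)} \] holds. Then $C\ge K_{\Phi,n}\sqrt{n}$, where $K_{\Phi,n}=\|\alpha_n\|_{L_\Phi(S_n)}$.
   Context: An $N$-function is an even, convex and continuous function $\Phi:\mathbb{R}\to[0,\infty)$ such that $\Phi(0)=0$, $\Phi(u)>0$ for $u\neq 0$, $\lim_{u\to0}\Phi(u)/u=0$ and $\lim_{u\to\infty}\Phi(u)/u=\infty$. For a probability space $(E,\mathcal{A},\mu)$ and an $N$-function $\Phi$, the Orlicz space $L_\Phi(E)$ consists of all measurable functions $f:E\to\mathbb{R}$ for which there exists $\lambda>0$ with $\int_E\Phi(|f|/\lambda)\,d\mu<\infty$; it carries the Luxemburg norm \[ \|f\|_{L_\Phi(E)}=\inf\Big\{\lambda>0:\ \int_E\Phi\Big(\frac{|f|}{\lambda}\Big)\,d\mu\le 1\Big\}. \] Also $\|f\|_{L^2(E)}=\big(\int_E|f|^2\,d\mu\big)^{1/2}$. Functions equal $\mu$-almost everywhere are identified, so linear independence is understood modulo $\mu$-almost everywhere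 equality (i.e. in $L^2(E)$). $S_n=\{x\in\mathbb{R}^n:\ \sum_{k=1}^n x_k^2=1\}$ is the unit sphere in $\mathbb{R}^n$, equipped with the normalized surface measure $ds$ (the rotation-invariant probability measure), and $L_\Phi(S_n)$ is the Orlicz space for this probability space. The function $\alpha_n:S_n\to\mathbb{R}$ is the last coordinate function: $\alpha_n(s)=x_n$ for $s=(x_1,\dots,x_n)\in S_n$. *)

(* Defs.v *)
From HB Require Import structures.
From mathcomp Require Export all_boot all_order all_algebra.
From mathcomp Require Export all_classical all_reals all_analysis.

Set Implicit Arguments.
Unset Strict Implicit.
Unset Printing Implicit Defensive.

Import Order.TTheory GRing.Theory Num.Theory.
Import numFieldNormedType.Exports.

Local Open Scope classical_set_scope.
Local Open Scope ring_scope.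

Record N_function (R : realType) (Phi : R -> R) : Prop := {
  N_function_ge0 : forall u, 0 <= Phi u ;
  N_function_even : forall u, Phi (- u) = Phi u ;
  N_function_convex : convex_function [set: R] Phi ;
  N_function_continuous : continuous Phi ;
  N_function0 : Phi 0 = 0 ;
  N_function_gt0 : forall u, u != 0 -> 0 < Phi u ;
  N_function_lim0 : Phi u / u @[u --> 0^'] --> 0 ;
  N_function_limy : Phi u / u @[u --> +oo] --> +oo }.

Section orlicz.
Context d (T : measurableType d) (R : realType).
Implicit Types (mu : {measure set T -> \bar R}) (Phi : R -> R) (f : T -> R).

Definition orlicz_space mu Phi : set (T -> R) :=
  [set f : T -> R | measurable_fun [set: T] f /\
    exists2 l : R, 0 < l & (\int[mu]_t (Phi (`|f t| / l))%:E < +oo)%E].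

(* The infimum is taken in [\bar R], so that the norm of a function outside of
   the Orlicz space is [+oo]. *)
Definition luxemburg_norm mu Phi f : \bar R :=
  ereal_inf [set l%:E | l in
    [set l : R | 0 < l /\ (\int[mu]_t (Phi (`|f t| / l))%:E <= 1)%E]].

Definition ae_linearly_independent mu n (f : 'I_n -> T -> R) : Prop :=
  forall a : 'I_n -> R,
    {ae mu, forall t, \sum_(k < n) a k * f k t = 0} -> forall k, a k = 0.

End orlicz.

Section sphere.
Variables (R : realType) (n : nat).

Definition sphere_set : set 'rV[R]_n.+1 :=
  [set x | \sum_(k < n.+1) x ord0 k ^+ 2 = 1].

(* The topology of [set_type] is the subspace topology of R^(n+1). *)
Definition unit_sphere : Type := set_type sphere_set.

HB.instance Definition _ := Topological.copy unit_sphere (set_type sphere_set).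

Lemma delta_sphere_set : delta_mx ord0 ord_max \in sphere_set.
Proof.
rewrite inE /sphere_set /= (bigD1 ord_max)//= mxE !eqxx expr1n.
rewrite big1 ?addr0// => k /negPf kn.
by rewrite mxE kn expr0n.
Qed.

HB.instance Definition _ := isPointed.Build unit_sphere
  (exist (fun x => x \in sphere_set) _ delta_sphere_set).

Definition borel_sphere := g_sigma_algebraType (@open unit_sphere).

Definition sphere_val (s : borel_sphere) : 'rV[R]_n.+1 := \val (s : unit_sphere).

Definition last_coord (s : borel_sphere) : R := sphere_val s ord0 ord_max.

Lemma rotate_sphere_set (Q : 'M[R]_n.+1) (QQ : Q *m Q^T = 1%:M)
  (s : borel_sphere) : sphere_val s *m Q \in sphere_set.
Proof.
have sumE (x : 'rV[R]_n.+1) :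
    \sum_(k < n.+1) x ord0 k ^+ 2 = (x *m x^T) ord0 ord0.
  by rewrite mxE; apply: eq_bigr => k _; rewrite mxE.
rewrite inE /sphere_set /= sumE trmx_mul mulmxA -(mulmxA _ Q) QQ mulmx1 -sumE.
exact: (set_mem (valP (s : unit_sphere))).
Qed.

Definition rotate (Q : 'M[R]_n.+1) (QQ : Q *m Q^T = 1%:M)
    (s : borel_sphere) : borel_sphere :=
  exist (fun x => x \in sphere_set) _ (rotate_sphere_set QQ s).

(* The normalized surface measure is the only Borel probability measure
   satisfying this predicate. All orthogonal matrices are allowed, and not only
   those of determinant 1, so that this also holds for the sphere {-1, 1}
   of R^1. *)
Definition rotation_invariant (sigma : probability borel_sphere R) : Prop :=
  forall (Q : 'M[R]_n.+1) (QQ : Q *m Q^T = 1%:M) (A : set borel_sphere),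
    measurable A -> sigma (rotate QQ @^-1` A) = sigma A.

End sphere.

(* Main.v *)
Require Import Defs.
From mathcomp Require Import measurable_realfun ring lra.

(** Let [N = n.+1] and let [r = |g|^2], where [g = (g_1, ..., g_N)] is an
    orthonormal basis of the span of the [f_k] in [L^2(E)]. For every [s] on the
    sphere the function [<s, g>] has [L^2] norm [1], so that its Luxemburg norm
    is at most [C] and [\int_E Phi(<s, g> / c) <= 1] for every [c > C]. This is
    averaged over [s] with respect to [sigma]. After Tonelli's theorem the inner
    integral is that of [Phi(<s, g t> / c)] over the sphere; since [sigma] is
    invariant under the reflection that maps [g t / |g t|] to the last basis
    vector, it equals [S(r t)], where
    [S u = \int_sphere Phi(sqrt u * s_N / c)]. Hence [\int_E S(r) <= 1].

    The function [u |-> Phi(sqrt u * z) = Psi(u z^2)] is convex, and so is its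
    average [S]. Because [\int_E r = N], Jensen's inequality yields [S(N) <= 1],
    that is [\int_sphere Phi(sqrt N * s_N / c) <= 1]. This says that the
    Luxemburg norm of the last coordinate is at most [c / sqrt N], and it remains
    to let [c] decrease to [C].

    The system [g] comes from a matrix [A] with [A G A^T = 1], where [G] is the
    Gram matrix of [f] ([posdef_congr1]). The other steps are
    [rotation_invariant_spherical_average], [spherical_average_convex] and
    [convex_jensen]. *)

Set Implicit Arguments.
Unset Strict Implicit.
Unset Printing Implicit Defensive.

Import Order.TTheory GRing.Theory Num.Theory.
Import numFieldNormedType.Exports.

Local Open Scope classical_set_scope.
Local Open Scope ring_scope.

(** * Convex functions and Jensen's inequality *)

(** Convexity in terms of real weights, instead of the abstract convex
    combinations over [{i01 R}]. *)
Lemma convex_functionP (R : realType) (D : set R) (g : R -> R) :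
  convex_function D g <->
  (forall t x y, 0 <= t -> t <= 1 -> D x -> D y ->
    g (t * x + (1 - t) * y) <= t * g x + (1 - t) * g y).
Proof.
split=> [cg t x y t0 t1 Dx Dy|cg t x y /set_mem Dx /set_mem Dy].
  exact: (cg (Itv01 t0 t1) x y (mem_set Dx) (mem_set Dy)).
exact: cg.
Qed.

Lemma supporting_line (R : realType) (g : R -> R) (z : R) : 0 < z ->
  convex_function (`[0, +oo[%classic : set R) g ->
  exists m, forall v, 0 <= v -> g z + m * (v - z) <= g v.
Proof.
move=> z0 /convex_functionP cg.
have Dge x : 0 <= x -> (`[0, +oo[%classic : set R) x.
  by move=> x0; rewrite /= in_itv /= x0.
have slope x y : 0 <= x -> x < z -> z < y ->
    (g z - g x) / (z - x) <= (g y - g z) / (y - z).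
  move=> x0 xz zy.
  have yx : 0 < y - x by lra.
  have t0 : 0 <= (y - z) / (y - x) by apply: divr_ge0; lra.
  have t1 : (y - z) / (y - x) <= 1 by rewrite ler_pdivrMr//; lra.
  have := cg _ x y t0 t1 (Dge _ x0) (Dge _ (ltW (lt_trans z0 zy))).
  have -> : (y - z) / (y - x) * x + (1 - (y - z) / (y - x)) * y = z.
    by field; rewrite gt_eqF.
  have -> : (y - z) / (y - x) * g x + (1 - (y - z) / (y - x)) * g y =
      ((y - z) * g x + (z - x) * g y) / (y - x).
    by field; rewrite gt_eqF.
  rewrite ler_pdivlMr// => h.
  rewrite ler_pdivrMr; last lra.
  rewrite mulrAC ler_pdivlMr; last lra.
  nra.
(* The slope of the supporting line is the left derivative at z, which is the
   supremum of the slopes of the chords that end at z. *)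
pose S := [set (g z - g x) / (z - x) | x in [set x | 0 <= x < z]].
have S0 : S !=set0 by exists ((g z - g 0) / (z - 0)), 0 => //=; rewrite lexx.
have zz : z < z + 1 by lra.
have Sub y : z < y -> ubound S ((g y - g z) / (y - z)).
  by move=> zy _ [x /andP[x0 xz] <-]; exact: slope.
exists (sup S) => v v0.
have [vz|zv|->] := ltgtP v z; last by rewrite subrr mulr0 addr0.
- have : (g z - g v) / (z - v) <= sup S.
    apply: ub_le_sup; first by exists ((g (z + 1) - g z) / (z + 1 - z)); exact: Sub.
    by exists v => //=; rewrite v0.
  rewrite ler_pdivrMr; last lra.
  nra.
- have : sup S <= (g v - g z) / (v - z) by apply: ge_sup => //; exact: Sub.
  rewrite ler_pdivlMr; last lra.
  nra.
Qed.

Lemma Rintegral_sum d (T : measurableType d) (R : realType)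
    (mu : {measure set T -> \bar R}) (I : Type) (s : seq I) (h : I -> T -> R) :
  (forall i, mu.-integrable setT (EFin \o h i)) ->
  mu.-integrable setT (EFin \o (fun t => \sum_(i <- s) h i t)) /\
  \int[mu]_t (\sum_(i <- s) h i t) = \sum_(i <- s) \int[mu]_t h i t.
Proof.
move=> ih; elim: s => [|i s [IH1 IH2]].
  split.
    rewrite (_ : _ \o _ = cst 0%E); first exact: integrable0.
    by apply/funext => t /=; rewrite big_nil.
  by under eq_Rintegral do rewrite big_nil; rewrite big_nil Rintegral_cst// mul0r.
have -> : (fun t => \sum_(j <- i :: s) h j t) =
    (fun t => h i t + \sum_(j <- s) h j t).
  by apply/funext => t; rewrite big_cons.
split; last by rewrite big_cons RintegralD// IH2.
exact: (integrableD measurableT (ih i) IH1).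
Qed.

(** Jensen's inequality. *)
Lemma convex_jensen d (T : measurableType d) (R : realType)
    (mu : probability T R) (G : R -> R) (r : T -> R) :
  convex_function (`[0, +oo[%classic : set R) G ->
  (forall t, 0 <= r t) -> 0 < \int[mu]_t r t ->
  mu.-integrable setT (EFin \o r) -> mu.-integrable setT (EFin \o (G \o r)) ->
  G (\int[mu]_t r t) <= \int[mu]_t G (r t).
Proof.
move=> cG r0 z0 ir iG; set z := Rintegral _ _ r in z0 *.
have [m hm] := supporting_line z0 cG.
have icst c : mu.-integrable setT (EFin \o cst c).
  exact: finite_measure_integrable_cst.
have imr : mu.-integrable setT (EFin \o (fun t => m * r t)).
  exact: (integrableZl measurableT m ir).
have iline : mu.-integrable setT (EFin \o (fun t => cst (G z - m * z) t + m * r t)).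
  exact: (integrableD measurableT (icst _) imr).
have -> : G z = \int[mu]_t (cst (G z - m * z) t + m * r t).
  rewrite RintegralD ?RintegralZl ?Rintegral_cst//.
  rewrite -/z [fine (mu _)](_ : _ = 1); first by rewrite mulr1 subrK.
  by have -> : (mu [set: T] = 1)%E by exact: probability_setT.
apply: le_Rintegral => // t _ /=.
by have := hm _ (r0 t); lra.
Qed.

(** * N-functions and the Luxemburg norm *)

Lemma N_function_le (R : realType) (Phi : R -> R) : N_function Phi ->
  forall x y, 0 <= x -> x <= y -> Phi x <= Phi y.
Proof.
move=> PhiN x y x0 xy.
have [y0|y0] := ltP 0 y; last by have -> : x = y by lra.
have t0 : 0 <= x / y by exact: divr_ge0 (ltW y0).
have t1 : x / y <= 1 by rewrite ler_pdivrMr// mul1r.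
have := (convex_functionP _ _).1 (N_function_convex PhiN) _ y 0 t0 t1 I I.
rewrite (N_function0 PhiN) !mulr0 !addr0 divfK ?gt_eqF// => /le_trans; apply.
by rewrite ler_piMl// (N_function_ge0 PhiN).
Qed.

Section luxemburg.
Context d (T : measurableType d) (R : realType) (mu : {measure set T -> \bar R}).
Variables (Phi : R -> R) (PhiN : N_function Phi).

Lemma measurable_N_function : measurable_fun setT Phi.
Proof. exact: continuous_measurable_fun (N_function_continuous PhiN). Qed.

Lemma N_function_norm u : Phi `|u| = Phi u.
Proof. by case: (ger0P u) => _ //; rewrite (N_function_even PhiN). Qed.

Lemma luxemburg_norm_ge0 (f : T -> R) : (0 <= luxemburg_norm mu Phi f)%E.
Proof. by apply: le_ereal_inf_tmp => _ [l [l0 _] <-]; rewrite lee_fin ltW. Qed.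

Lemma luxemburg_norm_le (f : T -> R) c : 0 < c ->
  (\int[mu]_t (Phi (`|f t| / c))%:E <= 1)%E -> (luxemburg_norm mu Phi f <= c%:E)%E.
Proof. by move=> c0 h; apply: ereal_inf_lbound; exists c. Qed.

(** A number above the Luxemburg norm is admissible in its definition. As [Phi]
    is even, the absolute value can be left out. *)
Lemma luxemburg_norm_lt (f : T -> R) c : measurable_fun setT f ->
  (luxemburg_norm mu Phi f < c%:E)%E ->
  (\int[mu]_t (Phi (f t / c))%:E <= 1)%E.
Proof.
move=> mf /ereal_inf_lt[_ [l [l0 fl] <-]]; rewrite lte_fin => lc.
have c0 : 0 < c := lt_trans l0 lc.
apply: le_trans fl; apply: ge0_le_integral => //.
- by move=> t _; rewrite lee_fin (N_function_ge0 PhiN).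
- apply/measurable_EFinP; apply: (measurableT_comp measurable_N_function).
  exact: measurable_funM.
- apply/measurable_EFinP; apply: (measurableT_comp measurable_N_function).
  by apply: measurable_funM => //; exact: measurableT_comp.
- move=> t _; rewrite lee_fin -N_function_norm normrM.
  rewrite (gtr0_norm (_ : 0 < c^-1)) ?invr_gt0//.
  apply: (N_function_le PhiN); first by rewrite divr_ge0// ltW.
  by rewrite ler_wpM2l// lef_pV2// ltW.
Qed.

End luxemburg.

(** * Orthogonal matrices and positive definite forms *)

(** A positive definite symmetric matrix is congruent to the identity. This is
    the Gram-Schmidt process for the form [G], carried out one row at a time:
    one step splits off the first coordinate and leaves a Schur complement. *)
Lemma posdef_congr1 (R : rcfType) n (G : 'M[R]_n) : G^T = G ->
  (forall v : 'rV_n, v != 0 -> 0 < (v *m G *m v^T) ord0 ord0) ->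
  exists A : 'M[R]_n, A *m G *m A^T = 1%:M.
Proof.
elim: n G => [|n IH] G.
  by exists 1%:M; apply/matrixP => -[].
rewrite -[n.+1]/(1 + n)%N in G * => Gsym Gpos.
pose a := G ord0 ord0.
pose b : 'rV[R]_n := ursubmx G.
pose D : 'M[R]_n := drsubmx G.
have GE : G = block_mx a%:M b b^T D.
  rewrite -{1}[G]submxK; congr block_mx.
    by rewrite [LHS]mx11_scalar; congr (_%:M); rewrite !mxE; congr (G _ _); exact/val_inj.
  by rewrite /b trmx_ursub Gsym.
have DT : D^T = D by rewrite /D trmx_drsub Gsym.
have a0 : 0 < a.
  have := Gpos (delta_mx ord0 ord0).
  rewrite -rowE trmx_delta -colE !mxE; apply.
  by apply/eqP => /matrixP/(_ ord0 ord0); rewrite !mxE !eqxx => /eqP; rewrite oner_eq0.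
have an : a != 0 by rewrite gt_eqF.
pose L : 'M[R]_(1 + n) := block_mx 1%:M 0 (- (a^-1 *: b^T)) 1%:M.
(* The Schur complement of the upper left entry. *)
pose S := D - a^-1 *: (b^T *m b).
have LGL : L *m G *m L^T = block_mx a%:M 0 0 S.
  rewrite GE /L tr_block_mx !mulmx_block !trmx1 !trmx0 linearN /= linearZ /= trmxK.
  rewrite !mul1mx !mul0mx !mulmx1 !mulmx0 !addr0.
  rewrite mulNmx -scalemxAl mul_mx_scalar scalerA mulVf// scale1r addNr mul0mx add0r.
  rewrite mulmxN -scalemxAr mul_scalar_mx scalerA mulVf// scale1r addNr.
  by rewrite mulNmx -scalemxAl addrC.
have ST : S^T = S.
  by rewrite /S linearB /= linearZ /= trmx_mul trmxK DT.
have Spos (v : 'rV[R]_n) : v != 0 -> 0 < (v *m S *m v^T) ord0 ord0.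
  move=> v0.
  have <- : row_mx 0 v *m L *m G *m (row_mx 0 v *m L)^T = v *m S *m v^T.
    rewrite trmx_mul -!mulmxA (mulmxA G) (mulmxA L) (mulmxA L G) LGL.
    rewrite tr_row_mx mul_block_col mul_row_col trmx0.
    by rewrite mul0mx add0r mulmx0 add0r mulmxA.
  apply: (Gpos (row_mx 0 v *m L)); rewrite mul_row_block !mulmx1 mulmx0 !add0r.
  by rewrite row_mx_eq0 negb_and v0 orbT.
have [A' A'E] := IH S ST Spos.
exists (block_mx (Num.sqrt a)^-1%:M 0 0 A' *m L).
rewrite trmx_mul -!mulmxA (mulmxA G) (mulmxA L) (mulmxA L G) LGL.
rewrite tr_block_mx !mulmx_block !trmx0 !mulmx0 !mul0mx !addr0 !add0r.
rewrite (mulmxA A') A'E tr_scalar_mx -!scalar_mxM scalar_mx_block.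
congr (block_mx _%:M _ _ _); rewrite ?mulmx0//.
by rewrite -{2}(sqr_sqrtr (ltW a0)) expr2; field; rewrite gt_eqF// sqrtr_gt0.
Qed.

(** Every vector is, up to its Euclidean norm, the image of the last basis vector
    under an orthogonal matrix. *)
Lemma householder (R : rcfType) n (v : 'rV[R]_n.+1) :
  exists2 Q : 'M[R]_n.+1, Q *m Q^T = 1%:M &
  forall s : 'rV_n.+1, \sum_k s ord0 k * v ord0 k =
    Num.sqrt (\sum_k v ord0 k ^+ 2) * (s *m Q) ord0 ord_max.
Proof.
have dotE (x y : 'rV[R]_n.+1) : \sum_k x ord0 k * y ord0 k = (x *m y^T) ord0 ord0.
  by rewrite mxE; apply: eq_bigr => k _; rewrite mxE.
have [->|v0] := eqVneq v 0.
  exists 1%:M => [|s]; first by rewrite trmx1 mulmx1.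
  rewrite dotE trmx0 mulmx0 mxE big1 ?sqrtr0 ?mul0r// => k _.
  by rewrite mxE expr0n.
have sqE (x : 'rV[R]_n.+1) : \sum_k x ord0 k ^+ 2 = (x *m x^T) ord0 ord0.
  by rewrite -dotE; apply: eq_bigr.
have sq_gt0 (x : 'rV[R]_n.+1) : x != 0 -> 0 < (x *m x^T) ord0 ord0.
  move=> x0; rewrite -sqE lt_neqAle sumr_ge0 ?andbT; last by move=> *; exact: sqr_ge0.
  apply: contraNneq x0 => /esym/eqP; rewrite psumr_eq0; last by move=> *; exact: sqr_ge0.
  move=> /allP h; apply/eqP/rowP => i; rewrite mxE.
  by have := h i (mem_index_enum _); rewrite /= sqrf_eq0 => /eqP.
have vv : v *m v^T = ((v *m v^T) ord0 ord0)%:M by rewrite [LHS]mx11_scalar.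
set r := Num.sqrt _.
have r0 : 0 < r by rewrite sqrtr_gt0 sqE sq_gt0.
have r2 : (v *m v^T) ord0 ord0 = r ^+ 2.
  by rewrite sqr_sqrtr sqE// ltW// sq_gt0.
pose e : 'rV[R]_n.+1 := delta_mx ord0 ord_max.
pose w := r^-1 *: v.
have ww : w *m w^T = 1%:M.
  rewrite /w linearZ /= -scalemxAl -scalemxAr scalerA vv r2 scale_scalar_mx.
  by congr (_%:M); field; rewrite gt_eqF.
have ee : e *m e^T = 1%:M.
  by rewrite /e trmx_delta mul_delta_mx; apply/matrixP => i j; rewrite !mxE !ord1.
suff [Q QT [QQ eQ]] : exists2 Q : 'M[R]_n.+1, Q^T = Q & Q *m Q = 1%:M /\ w *m Q = e.
  exists Q => [|s]; first by rewrite QT.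
  have eQ' : e *m Q = w by rewrite -eQ -mulmxA QQ mulmx1.
  have -> : v = r *: w by rewrite /w scalerA divff ?gt_eqF// scale1r.
  have -> : (s *m Q) ord0 ord_max = (s *m w^T) ord0 ord0.
    by rewrite -eQ' trmx_mul QT mulmxA /e trmx_delta -colE [RHS]mxE.
  by rewrite dotE linearZ /= -scalemxAr mxE.
(* Q is the reflection in the hyperplane orthogonal to w - e, which exchanges w
   and e. *)
have [we|we] := eqVneq w e.
  by exists 1%:M; rewrite ?trmx1 ?mulmx1.
have [u uE] : {u | u = w - e} by exists (w - e).
pose q := (u *m u^T) ord0 ord0.
have q0 : 0 < q by apply: sq_gt0; rewrite uE subr_eq0.
have uu : u *m u^T = q%:M by rewrite [LHS]mx11_scalar.
exists (1%:M - (2 / q) *: (u^T *m u)).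
  by rewrite linearB /= trmx1 linearZ /= trmx_mul trmxK.
split.
  rewrite mulmxBl mul1mx mulmxBr mulmx1 -scalemxAl -scalemxAr mulmxA -(mulmxA _ u).
  rewrite uu mul_mx_scalar -scalemxAl !scalerA -scalerBl -addrA -opprD -scalerDl.
  suff -> : 2 / q + (2 / q - 2 / q * (2 / q * q)) = 0 by rewrite scale0r subr0.
  by field; rewrite gt_eqF.
pose k := (w *m e^T) ord0 ord0.
have wek : w *m e^T = k%:M by rewrite [LHS]mx11_scalar.
have ewk : e *m w^T = k%:M by rewrite -[LHS]trmxK trmx_mul trmxK wek tr_scalar_mx.
have wu : w *m u^T = (1 - k)%:M.
  by rewrite uE linearB /= mulmxBr ww wek raddfB.
have qk : q = 2 * (1 - k).
  rewrite /q {1}uE mulmxBl wu mxE uE linearB /= mulmxBr ewk ee !mxE /=; ring.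
rewrite mulmxBr mulmx1 -scalemxAr mulmxA wu mul_scalar_mx scalerA.
have -> : 2 / q * (1 - k) = 1.
  by move: q0; rewrite qk => q0; field; apply/eqP => k0; move: q0; lra.
by rewrite scale1r uE opprB addrC subrK.
Qed.

(** * Gram matrices *)

Section gram.
Context d (T : measurableType d) (R : realType) (mu : {measure set T -> \bar R}).
Variables (n : nat) (f : 'I_n -> T -> R).

(** The matrix of the [L^2] inner products of the [f_k]. *)
Definition gram : 'M[R]_n := \matrix_(i, j) \int[mu]_t (f i t * f j t).

(** The linear combination of the [f_k] whose coefficients form the row [a]. *)
Definition lincomb (a : 'rV[R]_n) (t : T) : R := \sum_k a ord0 k * f k t.

Hypothesis f_L2 : forall k, f k \in Lfun mu 2%:E.

Lemma measurable_L2 k : measurable_fun setT (f k).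
Proof. by have := f_L2 k; rewrite inE => /andP[/[!inE]]. Qed.

Lemma measurable_lincomb a : measurable_fun setT (lincomb a).
Proof.
apply: measurable_sum => k; apply: measurable_funM => //.
exact: measurable_L2.
Qed.

(** The square of the [L^2] norm is the quadratic form of the Gram matrix. *)
Lemma lincomb_sqr (a : 'rV[R]_n) :
  mu.-integrable setT (EFin \o (fun t => lincomb a t ^+ 2)) /\
  \int[mu]_t (lincomb a t ^+ 2) = (a *m gram *m a^T) ord0 ord0.
Proof.
have iff i j : mu.-integrable setT (EFin \o (fun t => f i t * f j t)).
  exact/Lfun1_integrable/(Lfun2_mul_Lfun1 (f_L2 i) (f_L2 j)).
have iaff i j : mu.-integrable setT
    (EFin \o (fun t => a ord0 i * a ord0 j * (f i t * f j t))).
  exact: (integrableZl measurableT _ (iff i j)).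
have -> : (fun t => lincomb a t ^+ 2) =
    (fun t => \sum_j \sum_i a ord0 i * a ord0 j * (f i t * f j t)).
  apply/funext => t; rewrite expr2 /lincomb mulr_sumr; apply: eq_bigr => j _.
  by rewrite mulr_suml; apply: eq_bigr => i _; ring.
have [|i1 ->] := @Rintegral_sum _ _ _ mu _ (index_enum 'I_n)
    (fun j t => \sum_i a ord0 i * a ord0 j * (f i t * f j t)).
  by move=> j; have [] := @Rintegral_sum _ _ _ mu _ (index_enum 'I_n)
    (fun i t => a ord0 i * a ord0 j * (f i t * f j t)) (fun i => iaff i j).
split => //; rewrite mxE; apply: eq_bigr => j _.
have [_ ->] := @Rintegral_sum _ _ _ mu _ (index_enum 'I_n)
    (fun i t => a ord0 i * a ord0 j * (f i t * f j t)) (fun i => iaff i j).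
rewrite !mxE mulr_suml; apply: eq_bigr => i _.
rewrite RintegralZl// !mxE; ring.
Qed.

Lemma Lnorm_lincomb (a : 'rV[R]_n) :
  ('N[mu]_2%:E[EFin \o lincomb a] = (Num.sqrt ((a *m gram *m a^T) ord0 ord0))%:E)%E.
Proof.
have [ia ea] := lincomb_sqr a.
rewrite unlock /= (@eq_integral _ _ _ _ _ (fun t => (lincomb a t ^+ 2)%:E)); last first.
  by move=> t _ /=; rewrite powR_mulrn// real_normK ?num_real.
rewrite poweR12_sqrt; last by apply: integral_ge0 => t _; rewrite lee_fin sqr_ge0.
rewrite -ea /Rintegral.
by rewrite -[in LHS](fineK (integrable_fin_num measurableT ia)).
Qed.

Lemma gram_sym : gram^T = gram.
Proof.
by apply/matrixP => i j; rewrite !mxE; apply: eq_Rintegral => t _; rewrite mulrC.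
Qed.

Lemma gram_pos (a : 'rV[R]_n) : ae_linearly_independent mu f -> a != 0 ->
  0 < (a *m gram *m a^T) ord0 ord0.
Proof.
move=> fi a0; have [ia ea] := lincomb_sqr a.
rewrite -ea lt_neqAle Rintegral_ge0 ?andbT; last by move=> t _; exact: sqr_ge0.
apply: contra a0 => /eqP e0.
apply/eqP/rowP => k; rewrite mxE; apply: (fi (fun k => a ord0 k)).
have /(ae_eq_integral_abs mu measurableT (measurable_int mu ia)) :
    (\int[mu]_t `|(lincomb a t ^+ 2)%:E| = 0)%E.
  under eq_integral do rewrite /= ger0_norm ?sqr_ge0//.
  by rewrite -(fineK (integrable_fin_num measurableT ia)) -/(Rintegral _ _ _) -e0.
apply: filterS => t /(_ I) /= [] /eqP.
by rewrite sqrf_eq0 => /eqP.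
Qed.

End gram.

(** * The rotation-invariant measure on the sphere *)

Lemma sphere_val_unit (R : realType) n (s : borel_sphere R n) :
  \sum_k sphere_val s ord0 k ^+ 2 = 1.
Proof. exact: (set_mem (valP (s : unit_sphere R n))). Qed.

Section sphere_measure.
Variables (R : realType) (n : nat).

Lemma continuous_sphere_val : continuous (fun s : unit_sphere R n => \val s).
Proof. exact: initial_continuous. Qed.

Lemma continuous_sphere_coord (k : 'I_n.+1) :
  continuous (fun s : unit_sphere R n => \val s ord0 k).
Proof.
move=> s; apply: (@continuous_comp _ _ _ (fun s : unit_sphere R n => \val s)
  (fun x : 'rV[R]_n.+1 => x ord0 k)).
  exact: continuous_sphere_val.
exact: coord_continuous.
Qed.

Lemma measurable_sphere_coord (k : 'I_n.+1) :
  measurable_fun [set: borel_sphere R n] (fun s => sphere_val s ord0 k).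
Proof.
apply: (measurability _ (RGenOpens.measurableE R)).
move=> _ [_ [x [y ->]] <-].
rewrite setTI; apply: sub_sigma_algebra.
have : open `]x, y[%classic by exact: itv_open.
by apply: open_comp => s _; exact: continuous_sphere_coord.
Qed.

Lemma measurable_rotate (Q : 'M[R]_n.+1) (QQ : Q *m Q^T = 1%:M) :
  measurable_fun [set: borel_sphere R n] (rotate QQ : _ -> borel_sphere R n).
Proof.
apply: (@measurability _ _ (borel_sphere R n) (borel_sphere R n) _ _
  (@open (unit_sphere R n))) => //.
move=> _ [B oB <-].
rewrite setTI; apply: sub_sigma_algebra.
apply: (open_comp _ oB) => s _.
(* The sphere carries the topology induced by R^(n+1), where s Q is the sum of
   the rows of Q weighted by the coordinates of s. *)
apply: (@continuous_comp_initial _ _ _ set_val (rotate QQ)) => {}s.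
rewrite (_ : _ \o _ = fun s : unit_sphere R n => \sum_k (\val s ord0 k *: row k Q));
  last first.
  by apply/funext => x /=; rewrite /rotate set_valE /sphere_val /=; rewrite mulmx_sum_row.
move: s; apply: continuous_big => [|k _ s].
  exact: add_continuous.
by apply: continuousZr_tmp; exact: continuous_sphere_coord.
Qed.

Lemma rotation_invariant_integral (sigma : probability (borel_sphere R n) R)
    (h : borel_sphere R n -> \bar R) (Q : 'M[R]_n.+1) (QQ : Q *m Q^T = 1%:M) :
  rotation_invariant sigma ->
  measurable_fun [set: borel_sphere R n] h -> (forall s, 0 <= h s)%E ->
  (\int[sigma]_s h (rotate QQ s) = \int[sigma]_s h s)%E.
Proof.
move=> sigma_inv mh h0.
have := @ge0_integral_pushforward _ _ _ _ R _ (measurable_rotate QQ) sigma setT h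
  measurableT mh (fun s _ => h0 s).
rewrite preimage_setT /= => <-.
apply: eq_measure_integral => [|mrot A mA _]; first exact: measurable_rotate.
exact: (sigma_inv Q QQ A mA).
Qed.

End sphere_measure.

(** * Spherical averages *)

Section spherical_average.
Variables (R : realType) (n : nat) (sigma : probability (borel_sphere R n) R).
Variables (Phi : R -> R) (PhiN : N_function Phi) (c : R).

(** The mean over the sphere of [Phi(<s, v> / c)] for a vector [v] with
    [|v|^2 = u]; the last coordinate axis is taken as the direction of [v]. *)
Definition spherical_average (u : R) : R :=
  \int[sigma]_s Phi (Num.sqrt u * (last_coord s / c)).

Lemma measurable_sphere_Phi u :
  measurable_fun [set: borel_sphere R n] (fun s => Phi (u * (last_coord s / c))).
Proof.
apply: (measurableT_comp (measurable_N_function PhiN)).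
apply: measurable_funM => //; apply: measurable_funM => //.
exact: measurable_sphere_coord.
Qed.

Lemma integrable_sphere_Phi u :
  sigma.-integrable setT (EFin \o (fun s => Phi (u * (last_coord s / c)))).
Proof.
apply: measurable_bounded_integrable => //.
- by apply: le_lt_trans (ltry 1); exact: probability_le1.
- exact: measurable_sphere_Phi.
exists (Phi (u / c)); split; first exact: num_real.
move=> x ux s _; apply: le_trans (ltW ux).
rewrite ger0_norm ?(N_function_ge0 PhiN)// -(N_function_norm PhiN).
rewrite -(N_function_norm PhiN (u / c)).
apply: (N_function_le PhiN) => //.
rewrite mulrCA normrM ler_piMl//.
rewrite -(@ler_pXn2r _ 2)// ?nnegrE// expr1n real_normK ?num_real//.
rewrite -(sphere_val_unit s) (bigD1 ord_max)//= lerDl.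
by apply: sumr_ge0 => k _; exact: sqr_ge0.
Qed.

Lemma spherical_averageE u :
  (\int[sigma]_s (Phi (Num.sqrt u * (last_coord s / c)))%:E =
   (spherical_average u)%:E)%E.
Proof.
rewrite /spherical_average /Rintegral fineK//.
exact: integrable_fin_num (integrable_sphere_Phi _).
Qed.

Lemma spherical_average_convex :
  convex_function (`[0, +oo[%classic : set R) (fun u : R => Phi (Num.sqrt u)) ->
  convex_function (`[0, +oo[%classic : set R) spherical_average.
Proof.
move=> /convex_functionP cPsi; apply/convex_functionP => t x y t0 t1 x0 y0.
have ix u := integrable_sphere_Phi (Num.sqrt u).
have iZ a u : sigma.-integrable setT
    (EFin \o (fun s => a * Phi (Num.sqrt u * (last_coord s / c)))).
  exact: (integrableZl measurableT a (ix u)).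
rewrite /spherical_average -!RintegralZl// -RintegralD//.
apply: le_Rintegral => //; first
  exact: (integrableD measurableT (iZ t x) (iZ (1 - t) y)).
move=> s _; set z := _ / c.
(* Convexity holds pointwise, since Phi (sqrt u * z) = Psi (u z^2). *)
have E u : 0 <= u -> Phi (Num.sqrt u * z) = Phi (Num.sqrt (u * z ^+ 2)).
  by move=> u0; rewrite sqrtrM// sqrtr_sqr -(N_function_norm PhiN) normrM
    ger0_norm// sqrtr_ge0.
move: x0 y0; rewrite /= !in_itv /= !andbT => x0 y0.
rewrite !E//; last by rewrite addr_ge0// mulr_ge0// subr_ge0.
have -> : (t * x + (1 - t) * y) * z ^+ 2 =
    t * (x * z ^+ 2) + (1 - t) * (y * z ^+ 2) by ring.
by apply: cPsi => //; rewrite /= in_itv /= andbT mulr_ge0// sqr_ge0.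
Qed.

(** The mean of [Phi(<s, v> / c)] depends only on the norm of [v]. *)
Lemma rotation_invariant_spherical_average (v : 'rV[R]_n.+1) :
  rotation_invariant sigma ->
  (\int[sigma]_s (Phi ((\sum_k sphere_val s ord0 k * v ord0 k) / c))%:E =
   (spherical_average (\sum_k v ord0 k ^+ 2))%:E)%E.
Proof.
move=> sigma_inv; have [Q QQ Qv] := householder v.
set r := \sum_k v ord0 k ^+ 2 in Qv *.
rewrite -spherical_averageE.
rewrite -(rotation_invariant_integral QQ sigma_inv
    (h := fun s => (Phi (Num.sqrt r * (last_coord s / c)))%:E)).
- by apply: eq_integral => s _; rewrite Qv -mulrA.
- apply/measurable_EFinP; exact: measurable_sphere_Phi.
- by move=> s; rewrite lee_fin (N_function_ge0 PhiN).
Qed.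

End spherical_average.

(** * The lower bound for the constant *)

Theorem theorem4 (R : realType) (n : nat) (Phi : R -> R)
    (PhiN : N_function Phi)
    (Psi_convex : convex_function (`[0, +oo[%classic : set R) (fun u : R => Phi (Num.sqrt u)))
    (d : measure_display) (E : measurableType d) (mu : probability E R)
    (f : 'I_n.+1 -> E -> R)
    (f_orlicz : forall k, orlicz_space mu Phi (f k))
    (f_L2 : forall k, f k \in Lfun mu 2%:E)
    (f_indep : ae_linearly_independent mu f)
    (C : R)
    (f_C : forall a : 'I_n.+1 -> R,
      (luxemburg_norm mu Phi (fun t => (\sum_(k < n.+1) a k * f k t)%R) <=
       C%:E *
       'N[mu]_2%:E[EFin \o (fun t => (\sum_(k < n.+1) a k * f k t)%R)])%E)
    (sigma : probability (borel_sphere R n) R)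
    (sigma_inv : rotation_invariant sigma) :
  (luxemburg_norm sigma Phi (@last_coord R n) *
    (Num.sqrt n.+1%:R)%:E <= C%:E)%E.
Proof.
have [A AG] : exists A : 'M[R]_n.+1, A *m gram mu f *m A^T = 1%:M.
  by apply: posdef_congr1 => [|v]; [exact: gram_sym|exact: gram_pos].
(* The functions g_j are orthonormal in L^2(E). *)
pose g t : 'rV[R]_n.+1 := \row_j lincomb f (row j A) t.
have lincombA (x : 'rV[R]_n.+1) t :
    lincomb f (x *m A) t = \sum_j x ord0 j * g t ord0 j.
  under [RHS]eq_bigr do rewrite mxE mulr_sumr.
  rewrite exchange_big /=; apply: eq_bigr => k _; rewrite mxE mulr_suml.
  by apply: eq_bigr => j _; rewrite mxE mulrA.
have gramA (x : 'rV[R]_n.+1) :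
    (x *m A) *m gram mu f *m (x *m A)^T = x *m x^T.
  by rewrite trmx_mul -!mulmxA (mulmxA (gram _ _)) (mulmxA A) (mulmxA A) AG mul1mx.
have lux_le s : (luxemburg_norm mu Phi (lincomb f (sphere_val s *m A)) <= C%:E)%E.
  apply: le_trans (f_C (fun k => (sphere_val s *m A) ord0 k)) _.
  rewrite (Lnorm_lincomb f_L2) gramA mxE.
  under eq_bigr do rewrite mxE -expr2.
  by rewrite sphere_val_unit sqrtr1 mule1.
have C0 : 0 <= C.
  rewrite -lee_fin; apply: le_trans (lux_le point); exact: luxemburg_norm_ge0.
pose N : R := n.+1%:R.
have N0 : 0 < Num.sqrt N by rewrite sqrtr_gt0 ltr0n.
(* Every c > C is positive and admissible for the Luxemburg norm of <s, g>. *)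
apply/lee_addgt0Pr => e e0; rewrite -EFinD; set c := C + e.
have Cc : C < c by rewrite ltrDl.
have c0 : 0 < c := le_lt_trans C0 Cc.
suff avgN : spherical_average sigma Phi c N <= 1.
  rewrite -lee_pdivlMr// -EFinM.
  apply: luxemburg_norm_le; first by rewrite mulr_gt0// invr_gt0.
  apply: le_trans (_ : ((spherical_average sigma Phi c N)%:E <= 1)%E);
    last by rewrite lee_fin.
  rewrite -spherical_averageE//; under eq_integral => s _.
    rewrite -(N_function_norm PhiN).
    rewrite normrM normr_id -normrM (N_function_norm PhiN) invf_div mulrCA.
    over.
  by [].
pose h (z : borel_sphere R n * E) : \bar R :=
  (Phi (lincomb f (sphere_val z.1 *m A) z.2 / c))%:E.
have h0 z : (0 <= h z)%E by rewrite lee_fin (N_function_ge0 PhiN).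
have mh : measurable_fun setT h.
  apply/measurable_EFinP/(measurableT_comp (measurable_N_function PhiN)).
  apply: measurable_funM => //; apply: measurable_sum => k.
  apply: measurable_funM.
    under eq_fun do rewrite mxE.
    apply: measurable_sum => j; apply: measurable_funM => //.
    exact: (measurableT_comp (measurable_sphere_coord j) measurable_fst).
  exact: (measurableT_comp (measurable_L2 f_L2 k) measurable_snd).
pose r t := \sum_k g t ord0 k ^+ 2.
have avgE t : (\int[sigma]_s h (s, t) = (spherical_average sigma Phi c (r t))%:E)%E.
  rewrite -rotation_invariant_spherical_average//.
  by apply: eq_integral => s _; rewrite /h lincombA.
(* The bounds on the integrals over E for a fixed s are averaged over the sphere,
   and Tonelli's theorem exchanges the two integrals. *)
have avg_le1 : (\int[mu]_t (spherical_average sigma Phi c (r t))%:E <= 1)%E.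
  under eq_integral do rewrite -avgE.
  rewrite -(fubini_tonelli h mh h0).
  have -> : (1 = \int[sigma]_s cst 1 s)%E.
    rewrite integral_cst// mul1e; exact/esym/probability_setT.
  apply: ge0_le_integral => //.
  - by move=> s _; exact: integral_ge0.
  - exact: (measurable_fun_fubini_tonelli_F h).
  - move=> s _; apply: luxemburg_norm_lt => //.
      exact: (measurable_lincomb f_L2 (sphere_val s *m A)).
    by apply: le_lt_trans (lux_le s) _; rewrite lte_fin.
(* The functions g_j have norm 1, and there are n.+1 of them. *)
have [ir er] : mu.-integrable setT (EFin \o r) /\ \int[mu]_t r t = N.
  have ig k := lincomb_sqr (mu := mu) f_L2 (row k A).
  have [|ir er] := @Rintegral_sum _ _ _ mu _ (index_enum 'I_n.+1)
    (fun k t => lincomb f (row k A) t ^+ 2); first by move=> k; have [] := ig k.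
  have rE : r = fun t => \sum_k lincomb f (row k A) t ^+ 2.
    by apply/funext => t; apply: eq_bigr => k _; rewrite mxE.
  rewrite rE; split=> //; rewrite er -[RHS](@mxtrace1 R n.+1).
  apply: eq_bigr => k _; have [_ ->] := ig k.
  by rewrite !rowE gramA trmx_delta mul_delta_mx !mxE !eqxx.
have iavg : mu.-integrable setT (EFin \o (spherical_average sigma Phi c \o r)).
  apply/integrableP; split.
    rewrite (_ : _ \o _ = fubini_G sigma h);
      last by apply/funext => t /=; rewrite -avgE.
    exact: (measurable_fun_fubini_tonelli_G h).
  apply: le_lt_trans (ltry 1); apply: le_trans avg_le1.
  rewrite le_eqVlt; apply/orP; left; apply/eqP; apply: eq_integral => t _ /=.
  by rewrite ger0_norm//; apply: Rintegral_ge0 => s _; exact: (N_function_ge0 PhiN).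
rewrite -er; apply: (@le_trans _ _ (\int[mu]_t spherical_average sigma Phi c (r t))).
  apply: convex_jensen => //; first exact: spherical_average_convex.
    by move=> t; apply: sumr_ge0 => k _; exact: sqr_ge0.
  by rewrite er ltr0n.
by rewrite -lee_fin /Rintegral fineK//; exact: integrable_fin_num iavg.
Qed.
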